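(* Let $G=\{\mathbf u\in\mathbb R^N:\ g_i(\mathbf u)\succ 0,\ 1\le i\le I\}$, let $\mathbb I_L\subseteq\{1,\dots,I\}$ be the set of indices $i$ for which $g_i$ is linear (affine), and let $G_L=\{\mathbf u\in\mathbb R^N:\ g_i(\mathbf u)\succ 0\ \ \forall i\in\mathbb I_L\}$ (with $G_L=\mathbb R^N$ if $\mathbb I_L=\emptyset$). Assume that a set $G_*$ is of the form $$G_*=\Big\{\mathbf u\in\mathbb R^N:\ \varphi_i(\mathbf u;\boldsymbol\theta_{i*})\succ 0\quad\forall\,\boldsymbol\theta_{i*}\in\Theta_i,\ 1\le i\le I\Big\},$$ with each $\varphi_i$ being linear (affine) with respect to $\mathbf u$ and satisfying $$\min_{\boldsymbol\theta_{i*}\in\Theta_i}\varphi_i(\mathbf u;\boldsymbol\theta_{i*})=\lambda_i(\mathbf u)\,g_i(\mathbf u)$$ with $\lambda_i(\mathbf u)>0$ for all $\mathbf u\in G_L$. Then $G_*=G$, and $G_*$ is the GQL representation of $G$.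
   Context: The index set $\{1,\dots,I\}$ is the union of two index sets $\mathbb I$ and $\widehat{\mathbb I}$. The symbol ''$\succ$'' in the $i$-th constraint means ''$>$'' if $i\in\mathbb I$ and ''$\ge$'' if $i\in\widehat{\mathbb I}$ (the same choice is used for $g_i$ and for $\varphi_i$). The functions $g_i$ of $\mathbf u\in\mathbb R^N$ may be linear or nonlinear and need not be concave. The set $G$ is a convex invariant region (admissible state set) of a time-dependent PDE system, and the nontrivial case is considered in which at least one $g_i$ is nonlinear, so that $G\subset G_L$ and $G\ne G_L$. ''Linear'' means affine in $\mathbf u$. The parameters $\boldsymbol\theta_{i*}$ (possible extra free auxiliary variables) are independent of $\mathbf u$ and have ranges $\Theta_i$. A set $G_*$ of the displayed form, with all $\varphi_i$ affine in $\mathbf u$, is called an equivalent linear representation (GQL representation, where GQL stands for geometric quasilinearization) of $G$ if $G_*=G$.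
   Formalization: The formal theorem adds that G_L has nonempty interior (the claim can fail otherwise), and requires the identity min φ_i = λ_i g_i on all of R^N when g_i is affine, and only on G_L for the other i (requiring it only on G_L for every i makes the claim false). *)

(* Defs.v *)
From mathcomp Require Import all_boot all_order all_algebra.
From mathcomp Require Import all_classical all_reals all_analysis.
Set Implicit Arguments.
Unset Strict Implicit.
Unset Printing Implicit Defensive.
Import Order.TTheory GRing.Theory Num.Theory.
Import numFieldNormedType.Exports.
Local Open Scope classical_set_scope.
Local Open Scope ring_scope.

Definition is_affine (R : realType) (N : nat) (f : 'rV[R]_N -> R) : Prop :=
  exists (a : 'rV[R]_N) (b : R), forall u, f u = \sum_j a 0 j * u 0 j + b.

(* [x "succ" 0] for the i-th constraint: ">" for i in Is, ">=" for i in Iw. It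
   is meant to be used when Is and Iw cover all the indices; an index lying in
   both sets gets the strict inequality. *)
Definition succ0 (R : realType) (m : nat) (Is Iw : set 'I_m) (i : 'I_m)
    (x : R) : Prop :=
  (Is i -> 0 < x) /\ (Iw i -> 0 <= x).

Section Sets.
Variables (R : realType) (N m : nat) (Is Iw : set 'I_m).

Definition admissible_set (g : 'I_m -> 'rV[R]_N -> R) : set 'rV[R]_N :=
  [set u | forall i, succ0 Is Iw i (g i u)].

Definition linear_indices (g : 'I_m -> 'rV[R]_N -> R) : set 'I_m :=
  [set i | is_affine (g i)].

Definition linear_set (g : 'I_m -> 'rV[R]_N -> R) : set 'rV[R]_N :=
  [set u | forall i, linear_indices g i -> succ0 Is Iw i (g i u)].

Definition lifted_set (T : 'I_m -> Type) (Theta : forall i, set (T i))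
    (phi : forall i, 'rV[R]_N -> T i -> R) : set 'rV[R]_N :=
  [set u | forall i t, Theta i t -> succ0 Is Iw i (phi i u t)].

Definition GQL_representation (T : 'I_m -> Type) (Theta : forall i, set (T i))
    (phi : forall i, 'rV[R]_N -> T i -> R) (G : set 'rV[R]_N) : Prop :=
  (forall i t, Theta i t -> is_affine (phi i ^~ t)) /\
  lifted_set Theta phi = G.

End Sets.

(* x is the attained minimum of F over A (in particular A is nonempty). *)
Definition is_minimum (R : realType) (U : Type) (A : set U) (F : U -> R)
    (x : R) : Prop :=
  (F @` A) x /\ lbound (F @` A) x.

(* Main.v *)
Require Import Defs.
From mathcomp Require Import all_boot all_order all_algebra.
From mathcomp Require Import all_classical all_reals all_analysis.
From mathcomp Require Import ring lra.
Import Order.TTheory GRing.Theory Num.Theory.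
Import numFieldNormedType.Exports.
Local Open Scope classical_set_scope.
Local Open Scope ring_scope.

(** Write [h i u] for the minimum of [phi i u] over [Theta i]. Since a minimum
is attained, [u] satisfies the [i]-th family of lifted constraints exactly when
[h i u] satisfies the [i]-th sign condition ([is_minimum_succ0]). At a point of
[G_L] the value [h i u] is a positive multiple of [g i u], so there the lifted
constraints and the original ones agree ([succ0_pmul]). Both inclusions follow,
once it is known that the lifted set lies inside [G_L].

That containment ([lifted_set_sub_linear_set]) is the heart of the proof: away
from [G_L] nothing is known about the sign of [lambda], so [h i u >= 0] does not
directly give [g i u >= 0]. What survives for an affine [g i] is that [h i]
vanishes wherever [g i] does, whatever [lambda] is, and that [h i] is concave as
a minimum of affine functions. Suppose [g i u < 0] at a point [u] of the lifted
set, and join [u] to an interior point [u0] of [G_L]. There [g i u0 > 0], for an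
affine function that is nonnegative on a set and negative somewhere cannot
vanish at an interior point of the set ([affine_gt0_interior]); so
[h i u0 > 0]. The segment crosses the hyperplane [g i = 0] strictly between its
ends, and at the crossing point [h i = 0]; but concavity makes [h i] positive
there, because [h i u0 > 0] and [h i u >= 0]. Under a strict sign condition
the value [g i u = 0] is excluded at once, since it would force [h i u = 0]. *)

Set Implicit Arguments.
Unset Strict Implicit.

Lemma is_affine_segment (R : realType) (N : nat) (f : 'rV[R]_N -> R) u v t :
  is_affine f -> f (u + t *: (v - u)) = (1 - t) * f u + t * f v.
Proof.
move=> [a [b fE]]; rewrite !fE !mulrDr !mulr_sumr addrACA -big_split /=.
congr (_ + _); last by ring.
by apply: eq_bigr => j _; rewrite !mxE; ring.
Qed.

Lemma interior_segment (R : realType) (N : nat) (A : set 'rV[R]_N) u v :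
  interior A u -> exists2 t : R, 0 < t & A (u + t *: (v - u)).
Proof.
rewrite /interior => /nbhs_ballP[e /= e0 eA].
(* [M] exceeds every coordinate of the direction in absolute value, so the
   step [e / M] moves each coordinate by less than [e]. *)
set M := 1 + \sum_j `|(v - u) 0 j|.
have M0 : 0 < M by rewrite ltr_pwDl// sumr_ge0.
have t0 : 0 < e / M by rewrite divr_gt0.
exists (e / M) => //; apply: eA; split=> // i j; rewrite ord1.
rewrite /ball /= !mxE opprD addrA subrr add0r normrN normrM gtr0_norm//.
rewrite mulrAC ltr_pdivrMr// ltr_pM2l// /M.
rewrite (bigD1 j)//= !mxE.
have : 0 <= \sum_(k < N | k != j) `|(v - u) 0 k| by rewrite sumr_ge0.
by lra.
Qed.

(** If [f] vanished at [u], a short step towards [v] would stay in [A] and make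
[f] negative. *)
Lemma affine_gt0_interior (R : realType) (N : nat) (f : 'rV[R]_N -> R)
    (A : set 'rV[R]_N) u v :
  is_affine f -> (forall w, A w -> 0 <= f w) -> interior A u -> f v < 0 ->
  0 < f u.
Proof.
move=> fa fA Au fv; rewrite lt_neqAle fA ?andbT; last exact: interior_subset.
apply/eqP => fu0; have [t t0 /fA] := interior_segment v Au.
by rewrite is_affine_segment// -fu0 mulr0 add0r leNgt pmulr_rlt0 ?fv.
Qed.

Lemma succ0_le (R : realType) (m : nat) (Is Iw : set 'I_m) i (x y : R) :
  x <= y -> succ0 Is Iw i x -> succ0 Is Iw i y.
Proof.
by move=> xy [xs xw]; split=> [/xs|/xw] h; [exact: lt_le_trans xy|
  exact: le_trans xy].
Qed.

Lemma succ0_pmul (R : realType) (m : nat) (Is Iw : set 'I_m) i (c x : R) :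
  0 < c -> succ0 Is Iw i (c * x) <-> succ0 Is Iw i x.
Proof. by move=> c0; rewrite /succ0 pmulr_rgt0// pmulr_rge0. Qed.

Lemma succ0_ge0 (R : realType) (m : nat) (Is Iw : set 'I_m) i (x : R) :
  Is `|` Iw = [set: 'I_m] -> succ0 Is Iw i x -> 0 <= x.
Proof.
move=> cover [xs xw]; have : (Is `|` Iw) i by rewrite cover.
by case=> [/xs/ltW|/xw].
Qed.

Lemma is_minimum_succ0 (R : realType) (m : nat) (Is Iw : set 'I_m) i
    (U : Type) (A : set U) (F : U -> R) x :
  is_minimum A F x ->
  (forall t, A t -> succ0 Is Iw i (F t)) <-> succ0 Is Iw i x.
Proof.
move=> [[t At Ft] lbx]; split=> [/(_ t At)|x0 s As]; first by rewrite Ft.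
by apply: succ0_le x0; apply: lbx; exists s.
Qed.

(** Concavity of the minimum: the parameter that is optimal at the point of the
segment selects one affine function, and this function lies above the minimum at
both ends. *)
Lemma minimum_affine_gt0 (R : realType) (N : nat) (U : Type) (A : set U)
    (F : 'rV[R]_N -> U -> R) u v t (x y z : R) :
  (forall s, A s -> is_affine (F ^~ s)) ->
  is_minimum A (F u) x -> is_minimum A (F v) y ->
  is_minimum A (F (u + t *: (v - u))) z ->
  0 < x -> 0 <= y -> 0 <= t < 1 -> 0 < z.
Proof.
move=> Fa [_ lbx] [_ lby] [[s As <-] _] x0 y0 /andP[t0 t1].
rewrite (is_affine_segment u v t (Fa s As)).
have xs : x <= F u s by apply: lbx; exists s.
have ys : y <= F v s by apply: lby; exists s.
apply: ltr_pwDl; first by rewrite mulr_gt0 ?subr_gt0// (lt_le_trans x0).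
by rewrite mulr_ge0// (le_trans y0).
Qed.

(** Outside [G_L] the factor [lambda] may have any sign, so only the zeros of
[g i] can be transferred to the minimum; the nonempty interior of [G_L] supplies
the point where the minimum is positive, and concavity does the rest. *)
Lemma lifted_set_sub_linear_set (R : realType) (N m : nat) (Is Iw : set 'I_m)
    (g : 'I_m -> 'rV[R]_N -> R)
    (T : 'I_m -> Type) (Theta : forall i, set (T i))
    (phi : forall i, 'rV[R]_N -> T i -> R)
    (lambda : 'I_m -> 'rV[R]_N -> R) :
  Is `|` Iw = [set: 'I_m] ->
  interior (linear_set Is Iw g) !=set0 ->
  (forall i t, linear_indices g i -> Theta i t -> is_affine (phi i ^~ t)) ->
  (forall i u, linear_indices g i ->
     is_minimum (Theta i) (phi i u) (lambda i u * g i u)) ->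
  (forall i u, linear_indices g i -> linear_set Is Iw g u ->
     0 < lambda i u) ->
  lifted_set Is Iw Theta phi `<=` linear_set Is Iw g.
Proof.
move=> cover [u0 u0int] phia phim lam0 u Gu i iL.
have u0L : linear_set Is Iw g u0 by exact: interior_subset u0int.
have hu : succ0 Is Iw i (lambda i u * g i u).
  exact/(is_minimum_succ0 Is Iw i (phim i u iL))/(Gu i).
have gu : 0 <= g i u.
  rewrite leNgt; apply/negP => gu0.
  have gu00 : 0 < g i u0.
    apply: (affine_gt0_interior iL _ u0int gu0) => w /(_ i iL).
    exact: succ0_ge0.
  (* Where the affine function [g i] crosses zero on the segment. *)
  pose t := g i u0 / (g i u0 - g i u).
  have d0 : 0 < g i u0 - g i u by lra.
  have t01 : 0 <= t < 1.
    by rewrite /t divr_ge0 ?(ltW d0) ?(ltW gu00)//= ltr_pdivrMr//; lra.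
  have gt0 : g i (u0 + t *: (u - u0)) = 0.
    by rewrite is_affine_segment// /t; field; rewrite gt_eqF.
  have := minimum_affine_gt0 (fun s => phia i s iL) (phim i u0 iL) (phim i u iL)
    (phim i (u0 + t *: (u - u0)) iL) _ (succ0_ge0 cover hu) t01.
  by rewrite gt0 mulr0 ltxx mulr_gt0 ?lam0// => /(_ isT).
split=> // is_i; rewrite lt_neqAle gu andbT; apply/eqP => gu0.
by have := hu.1 is_i; rewrite -gu0 mulr0 ltxx.
Qed.

Unset Implicit Arguments.
Set Strict Implicit.

Theorem theorem3p2 (R : realType) (N m : nat) (Is Iw : set 'I_m)
    (g : 'I_m -> 'rV[R]_N -> R)
    (T : 'I_m -> Type) (Theta : forall i, set (T i))
    (phi : forall i, 'rV[R]_N -> T i -> R)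
    (lambda : 'I_m -> 'rV[R]_N -> R)
    (I_cover : Is `|` Iw = [set: 'I_m])
    (G_convex : convex_set (admissible_set Is Iw g))
    (g_nonlinear : exists i, ~ is_affine (g i))
    (G_neq_GL : admissible_set Is Iw g <> linear_set Is Iw g)
    (GL_interior : interior (linear_set Is Iw g) !=set0)
    (phi_affine : forall i t, Theta i t -> is_affine (phi i ^~ t))
    (phi_min : forall i u, linear_indices g i \/ linear_set Is Iw g u ->
       is_minimum (Theta i) (phi i u) (lambda i u * g i u))
    (lambda_gt0 : forall i u, linear_set Is Iw g u -> 0 < lambda i u) :
  lifted_set Is Iw Theta phi = admissible_set Is Iw g /\
  GQL_representation Is Iw Theta phi (admissible_set Is Iw g).
Proof.
suff GE : lifted_set Is Iw Theta phi = admissible_set Is Iw g by [].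
have on_GL i u : linear_set Is Iw g u ->
    (forall t, Theta i t -> succ0 Is Iw i (phi i u t)) <->
    succ0 Is Iw i (g i u).
  move=> uL; rewrite (is_minimum_succ0 Is Iw i (phi_min i u (or_intror uL))).
  exact/succ0_pmul/lambda_gt0.
apply/seteqP; split=> u Gu.
  have uL : linear_set Is Iw g u.
    apply: (lifted_set_sub_linear_set I_cover GL_interior _ _ _ Gu).
    - by move=> i t _; exact: phi_affine.
    - by move=> i w iL; exact: phi_min (or_introl iL).
    - by move=> i w _; exact: lambda_gt0.
  by move=> i; apply/(on_GL i u uL) => t; exact: Gu.
have uL : linear_set Is Iw g u by move=> i _; exact: Gu.
by move=> i; apply/(on_GL i u uL); exact: Gu.
Qed.
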